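(* Let $r$ be a real number with $1\le r\le 4$. Then for every integer $n\ge 1$ the function $f:\mathbb{R}^n\to\mathbb{R}$, $$f(x)=\frac{1-\|x\|}{1-\|x\|^r},$$ is infinitely divisible on $\mathbb{R}^n$.
   Context: $\|\cdot\|$ is the Euclidean norm on $\mathbb{R}^n$. Convention: when $\|x\|=1$, the quotient is interpreted as its limiting value $f(x)=1/r$. Definitions. A continuous function $h:\mathbb{R}^n\to\mathbb{R}$ is called positive definite if for every $m\ge 1$ and every choice of points $x_1,\dots,x_m\in\mathbb{R}^n$ the $m\times m$ matrix $[h(x_i-x_j)]$ is positive semidefinite. A nonnegative function $h$ on $\mathbb{R}^n$ is called infinitely divisible if for every real $\alpha>0$ the function $h(x)^\alpha$ is positive definite. *)

(* Defs.v *)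
(* R^n is represented by 'rV[R]_n, over an arbitrary R : realType. *)
From HB Require Import structures.
From mathcomp Require Import all_boot all_order all_algebra.
From mathcomp Require Import all_classical all_reals all_analysis.
Set Implicit Arguments.
Unset Strict Implicit.
Unset Printing Implicit Defensive.
Import Order.TTheory GRing.Theory Num.Theory.
Import numFieldNormedType.Exports.
Local Open Scope ring_scope.

(* The canonical norm `|x| on row vectors is the sup norm, hence a separate
   Euclidean norm; both induce the canonical topology of 'rV[R]_n. *)
Definition enorm (R : realType) (n : nat) (x : 'rV[R]_n) : R :=
  Num.sqrt (\sum_(i < n) x 0 i ^+ 2).

Definition psdmx (R : realType) (m : nat) (A : 'M[R]_m) : Prop :=
  A^T = A /\ forall v : 'rV[R]_m, 0 <= (v *m A *m v^T) 0 0.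

Definition positive_definite (R : realType) (n : nat) (h : 'rV[R]_n -> R) :
    Prop :=
  continuous h /\
  forall (m : nat) (x : 'I_m -> 'rV[R]_n), (0 < m)%N ->
    psdmx (\matrix_(i < m, j < m) h (x i - x j)).

Definition infinitely_divisible (R : realType) (n : nat)
    (h : 'rV[R]_n -> R) : Prop :=
  (forall x, 0 <= h x) /\
  forall alpha : R, 0 < alpha -> positive_definite (fun x => h x `^ alpha).

(* At norm 1 the quotient takes its limiting value 1 / r. *)
Definition norm_quotient (R : realType) (r : R) (n : nat) (x : 'rV[R]_n) : R :=
  if enorm x == 1 then 1 / r
  else (1 - enorm x) / (1 - enorm x `^ r).

(* Main.v *)
Require Import Defs.
From HB Require Import structures.
From mathcomp Require Import all_boot all_order all_algebra.
From mathcomp Require Import all_classical all_reals all_analysis.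
From mathcomp Require Import measurable_realfun ring lra.
Set Implicit Arguments.
Unset Strict Implicit.
Unset Printing Implicit Defensive.
Import Order.TTheory GRing.Theory Num.Theory.
Import numFieldNormedType.Exports.
Local Open Scope classical_set_scope.
Local Open Scope ring_scope.

(** Write [phi r t = (1 - t) / (1 - t^r)].  A kernel on a finite set is
    conditionally negative definite (cnd) if its quadratic form is nonpositive
    on the vectors of sum zero.  The kernel [|x_i - x_j|^2] is cnd, and the
    positive semidefiniteness of [phi r (|x_i - x_j|)^al] is derived from this
    fact alone.

    Two reductions bring the range [1 <= r <= 4] to a linear statement.
    For [1 < r < 2] and [q = r - 1],
      [1 / phi r t = 1 + t (1 - t^q) / (1 - t)]
    (with [phi 1 = 1] and [1 / phi 2 t = 1 + t] at the ends), and for [r > 2],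
      [phi r t = phi (r / 2) (t^2) * (1 + t)^-1]
    where [r / 2] lies between 1 and 2.  So [phi r] is a product of reciprocals
    of functions [1], [1 + t] or [1 + t (1 - t^q) / (1 - t)], taken at
    [t = |x_i - x_j|] or [t = |x_i - x_j|^2].  Hence it suffices that, for a
    positive cnd kernel [K], the kernels [K^q] and [K (1 - K^q) / (1 - K)] are
    cnd for [0 < q < 1] ([cnd_powR], [cnd_powR_slope]), and that [K^-al] is
    positive semidefinite for [al > 0] ([psd_powRN]).

    All three follow from the resolvents [(la + K)^-1], which are positive
    semidefinite because they are, up to a diagonal scaling, geometric series
    in a positive semidefinite kernel of modulus less than 1 ([psd_inv_cnd],
    by the Schur product theorem [psdM]).  Indeed [t^(q-1)] is a positive
    superposition of the functions [(la + t)^-1], so that every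
    linear inequality satisfied by all resolvents passes to [t^(q-1)]
    ([powR_resolvent_cone]); and
      [t / (1 - t) * (1 / (la + 1) - t / (la + t)) = la / (la + 1) * t / (la + t)]
    turns [t (1 - t^q) / (1 - t)] into a superposition of
    [t / (la + t) = 1 - la (la + t)^-1].

    The points [t = 0] and [t = 1] are avoided by replacing [|x|^2] with
    [|x|^2 + e], with [e > 0] small, and are recovered by letting [e] tend to 0,
    as [phi r] is continuous on the nonnegative reals. *)

(** * Positive semidefinite and conditionally negative definite kernels *)
Section kernels.
Context {R : realType} {I : finType}.
Implicit Types (K L : I -> I -> R) (u v : I -> R).

Definition qform K v : R := \sum_(p : I * I) v p.1 * v p.2 * K p.1 p.2.

Definition psd K : Prop :=
  (forall i j, K i j = K j i) /\ forall v, 0 <= qform K v.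

Definition cnd K : Prop :=
  (forall i j, K i j = K j i) /\
  forall v, \sum_i v i = 0 -> qform K v <= 0.

Lemma eq_qform K L v : (forall i j, K i j = L i j) -> qform K v = qform L v.
Proof. by move=> e; apply: eq_bigr => p _; rewrite e. Qed.

Lemma eq_psd K L : (forall i j, K i j = L i j) -> psd L -> psd K.
Proof.
by move=> e [sL pL]; split=> [i j|v]; rewrite ?e // (eq_qform v e).
Qed.

Lemma eq_cnd K L : (forall i j, K i j = L i j) -> cnd L -> cnd K.
Proof.
by move=> e [sL pL]; split=> [i j|v v0]; rewrite ?e // (eq_qform v e) pL.
Qed.

Lemma qformD K L v : qform (fun i j => K i j + L i j) v = qform K v + qform L v.
Proof. by rewrite -big_split; apply: eq_bigr => p _; rewrite mulrDr. Qed.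

Lemma qformZ a K v : qform (fun i j => a * K i j) v = a * qform K v.
Proof. by rewrite mulr_sumr; apply: eq_bigr => p _; rewrite mulrCA. Qed.

Lemma qform_prod a b v :
  qform (fun i j => a i * b j) v = (\sum_i v i * a i) * (\sum_j v j * b j).
Proof.
rewrite /qform -(pair_bigA _ (fun i j => v i * v j * (a i * b j))) mulr_suml.
by apply: eq_bigr => i _; rewrite mulr_sumr; apply: eq_bigr => j _; rewrite mulrACA.
Qed.

Lemma qform_add_delta K v a i : (forall j k, K j k = K k j) ->
  qform K (fun j => v j + a * (j == i)%:R) =
  qform K v + (a * \sum_j K i j * v j) *+ 2 + a ^+ 2 * K i i.
Proof.
move=> sK.
pose e j : R := (j == i)%:R.
have sume (f : I -> R) : \sum_j e j * f j = f i.
  rewrite (bigD1 i) //= big1 ?addr0 /e ?eqxx ?mul1r // => j /negPf ->.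
  by rewrite mul0r.
have qE w : qform K w = \sum_j \sum_k w j * w k * K j k.
  by rewrite /qform -(pair_bigA _ (fun j k => w j * w k * K j k)).
rewrite !qE; transitivity (\sum_j \sum_k v j * v k * K j k
  + a * (\sum_j e j * \sum_k K j k * v k)
  + a * (\sum_j \sum_k e k * (K j k * v j))
  + a ^+ 2 * (\sum_j e j * \sum_k e k * K j k)); last first.
  have -> : \sum_j \sum_k e k * (K j k * v j) = \sum_k e k * \sum_j K k j * v j.
    rewrite exchange_big; apply: eq_bigr => k _; rewrite mulr_sumr.
    by apply: eq_bigr => j _; rewrite sK.
  by rewrite !sume; ring.
rewrite !mulr_sumr -!big_split; apply: eq_bigr => j _ /=.
rewrite !mulr_sumr -!big_split; apply: eq_bigr => k _ /=.
by rewrite /e; ring.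
Qed.

Lemma qform_delta K a i : (forall j k, K j k = K k j) ->
  qform K (fun j => a * (j == i)%:R) = a ^+ 2 * K i i.
Proof.
move=> sK; have := qform_add_delta (fun=> 0) a i sK.
rewrite big1 ?mulr0 ?mul0rn ?addr0 => [|j _]; last exact: mulr0.
rewrite [X in _ = X + _]big1 ?add0r => [<-|p _]; last by rewrite !mul0r.
by congr qform; apply/funext => j; rewrite add0r.
Qed.

Lemma psd_diag_ge0 K i : psd K -> 0 <= K i i.
Proof.
move=> [sK pK]; have := pK (fun j => 1 * (j == i)%:R).
by rewrite qform_delta // expr1n mul1r.
Qed.

(** The form is nonnegative at the vectors [e_i + e_j] and [e_i - e_j]. *)
Lemma psd_norm_le K i j : psd K -> `|K i j| <= (K i i + K j j) / 2.
Proof.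
move=> [sK pK].
have P a : 0 <= K i i + (a * K j i) *+ 2 + a ^+ 2 * K j j.
  have := pK (fun k => 1 * (k == i)%:R + a * (k == j)%:R).
  rewrite qform_add_delta // qform_delta // expr1n mul1r.
  rewrite (bigD1 i) //= big1 ?addr0 ?eqxx ?mulr1 // => k /negPf ->.
  by rewrite !mulr0.
rewrite (sK i j) ler_norml; have := P 1; have := P (- 1).
by rewrite sqrrN !expr1n; move=> *; apply/andP; split; lra.
Qed.

Lemma psd_rank1 u : psd (fun i j => u i * u j).
Proof. by split=> [i j|v]; rewrite ?qform_prod ?sqr_ge0 // mulrC. Qed.

Lemma psd0 : psd (fun _ _ => 0).
Proof. by split=> // v; rewrite /qform big1 // => p _; rewrite mulr0. Qed.

Lemma psdD K L : psd K -> psd L -> psd (fun i j => K i j + L i j).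
Proof.
move=> [sK pK] [sL pL]; split=> [i j|v]; first by rewrite sK sL.
by rewrite qformD addr_ge0.
Qed.

Lemma psdZ a K : 0 <= a -> psd K -> psd (fun i j => a * K i j).
Proof.
move=> a0 [sK pK]; split=> [i j|v]; first by rewrite sK.
by rewrite qformZ mulr_ge0.
Qed.

Lemma psd_scale u K : psd K -> psd (fun i j => u i * u j * K i j).
Proof.
move=> [sK pK]; split=> [i j|v]; first by rewrite sK (mulrC (u i)).
have -> : qform (fun i j => u i * u j * K i j) v = qform K (fun i => v i * u i).
  by apply: eq_bigr => p _; ring.
exact: pK.
Qed.

(** Gaussian elimination: subtracting from [K] the rank one kernel of its
    normalized [i]-th row leaves a positive semidefinite kernel with one more zero
    on the diagonal, and a zero diagonal forces a zero kernel. *)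
Lemma psd_gram K : psd K ->
  exists s : seq (I -> R), forall i j, K i j = \sum_(u <- s) u i * u j.
Proof.
have [n] := ubnP #|[pred i | K i i != 0]|.
elim: n K => // n IH K; rewrite ltnS => leKn psdK; have [sK pK] := psdK.
have [/existsP[i Ki0]|] := boolP [exists i, K i i != 0]; last first.
  rewrite negb_exists => /forallP K0; exists [::] => i j; rewrite big_nil.
  have := psd_norm_le i j psdK.
  rewrite (eqP (negPn (K0 i))) (eqP (negPn (K0 j))) addr0 mul0r normr_le0.
  by move/eqP.
have Ki : 0 < K i i by rewrite lt_neqAle eq_sym Ki0 psd_diag_ge0.
pose u j := K i j / Num.sqrt (K i i).
have uu j k : u j * u k = K i j * K i k / K i i.
  by rewrite /u mulrACA -invfM -expr2 sqr_sqrtr ?ltW.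
pose L j k := K j k - u j * u k.
have psdL : psd L.
  split=> [j k|v]; first by rewrite /L sK mulrC.
  pose b := \sum_j K i j * v j.
  (* Completing the square in the i-th coordinate. *)
  suff -> : qform L v = qform K (fun j => v j + (- (b / K i i)) * (j == i)%:R).
    exact: pK.
  rewrite qform_add_delta // -/b (@eq_qform L
    (fun j k => K j k + - (K i i)^-1 * (K i j * K i k))); last first.
    by move=> j k; rewrite /L uu; ring.
  rewrite qformD qformZ qform_prod.
  rewrite (eq_bigr (fun j => K i j * v j)) => [|j _]; last exact: mulrC.
  by rewrite -/b; field.
have [|s Ls] := IH L _ psdL.
  apply: leq_trans leKn; apply: proper_card; apply/properP; split.
    apply/fintype.subsetP => j; rewrite !inE; apply: contraNneq => Kj.
    rewrite eq_le psd_diag_ge0 // andbT /L Kj sub0r oppr_le0.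
    by rewrite -expr2 sqr_ge0.
  by exists i; rewrite !inE // /L uu -mulrA divff // mulr1 subrr eqxx.
by exists (u :: s) => j k; rewrite big_cons -Ls /L addrC subrK.
Qed.

(** Schur product theorem: by [psd_gram] one factor may be taken of rank one,
    and then the product is a diagonal congruence of the other factor. *)
Lemma psdM K L : psd K -> psd L -> psd (fun i j => K i j * L i j).
Proof.
move=> /psd_gram[s Ks] psdL.
apply: (@eq_psd _ (fun i j => \sum_(u <- s) u i * u j * L i j)).
  by move=> i j; rewrite Ks mulr_suml.
elim: s {Ks} => [|u s IH].
  by apply: eq_psd psd0 => i j; rewrite big_nil.
apply: eq_psd (psdD (psd_scale u psdL) IH) => i j.
by rewrite big_cons.
Qed.

Lemma psdX K n : psd K -> psd (fun i j => K i j ^+ n).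
Proof.
move=> psdK; elim: n => [|n IH].
  by apply: eq_psd (psd_rank1 (fun=> 1)) => i j; rewrite mulr1.
by apply: eq_psd (psdM psdK IH) => i j; rewrite exprS.
Qed.

Lemma psd_lim {T : Type} {F : set_system T} {FF : ProperFilter F}
    (A : T -> I -> I -> R) K :
  (forall i j, A t i j @[t --> F] --> K i j) ->
  (\forall t \near F, psd (A t)) -> psd K.
Proof.
move=> AK pA; split=> [i j|v].
  apply: (cvg_unique (@Rhausdorff R) (AK i j)).
  apply: cvg_trans (AK j i); apply: near_eq_cvg.
  by apply: filterS pA => t [sA _]; rewrite sA.
have cq : qform (A t) v @[t --> F] --> qform K v.
  apply: (@cvg_big _ _ _ _ _ add_continuous) => p _.
  by apply: cvgM; [exact: cvg_cst | exact: AK].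
rewrite -(cvg_lim (@Rhausdorff R) cq); apply: limr_ge.
  by apply/cvg_ex; exists (qform K v).
by apply: filterS pA => t [_].
Qed.

Lemma cndD K L : cnd K -> cnd L -> cnd (fun i j => K i j + L i j).
Proof.
move=> [sK pK] [sL pL]; split=> [i j|v v0]; first by rewrite sK sL.
by rewrite qformD -[0]addr0 lerD ?pK ?pL.
Qed.

Lemma cnd_cst a : cnd (fun _ _ => a).
Proof.
split=> // v v0.
rewrite (_ : qform _ v = qform (fun _ _ => a * 1) v); last first.
  by apply: eq_qform => i j; rewrite mulr1.
rewrite qform_prod (_ : \sum_j v j * 1 = 0) ?mulr0 // -[RHS]v0.
by apply: eq_bigr => i _; rewrite mulr1.
Qed.

Lemma cnd_cstB_psd a K : psd K -> cnd (fun i j => a - K i j).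
Proof.
move=> [sK pK]; apply: cndD (cnd_cst a) _; split=> [i j|v _]; first by rewrite sK.
rewrite (@eq_qform _ (fun i j => -1 * K i j)); last by move=> *; rewrite mulN1r.
by rewrite qformZ mulN1r oppr_le0.
Qed.

(** Moving the sum of a vector onto the base point [i0] gives a vector of sum zero
    without changing the value of this form, which on such vectors is opposite to
    that of [K]. *)
Lemma psd_base K i0 : cnd K ->
  psd (fun i j => K i i0 + K j i0 - K i0 i0 - K i j).
Proof.
move=> [sK pK]; split=> [i j|v]; first by rewrite (sK j i); ring.
pose V := \sum_i v i.
have := pK (fun i => v i + (- V) * (i == i0)%:R).
have d1 : \sum_i (i == i0)%:R = 1 :> R.
  by rewrite (bigD1 i0) //= eqxx big1 ?addr0 // => j /negPf ->.
rewrite qform_add_delta // big_split /= -mulr_sumr d1 mulr1 subrr.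
move/(_ erefl).
have sumv1 : \sum_i v i * 1 = V by apply: eq_bigr => i _; rewrite mulr1.
have vK : \sum_j v j * K i0 j = \sum_j K i0 j * v j.
  by apply: eq_bigr => j _; rewrite mulrC.
have := qform_prod (K i0) (fun=> 1) v; have := qform_prod (fun=> 1) (K i0) v.
have := qform_prod (fun=> 1) (fun=> 1) v; rewrite sumv1 vK => e11 e1K eK1.
have -> : qform (fun i j => K i i0 + K j i0 - K i0 i0 - K i j) v =
    qform (fun i j => K i0 i * 1) v + qform (fun i j => 1 * K i0 j) v
    + - K i0 i0 * qform (fun i j => 1 * 1) v + -1 * qform K v.
  rewrite -!qformZ -!qformD; apply: eq_qform => i j.
  by rewrite (sK i0 i) (sK i0 j); ring.
rewrite e11 e1K eK1.
by move=> ?; lra.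
Qed.

(** Fix a base point [z] and put [m i j = 1 - K z z * K i j / (K i z * K j z)].
    Then [m] is positive semidefinite, since
      [K i z * K j z * m i j = (K i z - K z z) * (K j z - K z z)
         + K z z * (K i z + K j z - K z z - K i j)],
    and [m i i < 1] as [K] is positive, whence [`|m i j| < 1].  So
      [(K i j)^-1 = K z z / (K i z * K j z) * \sum_n m i j ^+ n]
    is a limit of positive semidefinite kernels. *)
Lemma psd_inv_cnd K : (forall i j, 0 < K i j) -> cnd K ->
  psd (fun i j => (K i j)^-1).
Proof.
move=> K0 cK; have [sK _] := cK.
have [/existsP[z _]|] := boolP [exists i : I, true]; last first.
  rewrite negb_exists => /forallP no; split=> [i|v]; first by move: (no i).
  by apply: sumr_ge0 => p _; move: (no p.1).
pose m i j := 1 - K z z * K i j / (K i z * K j z).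
have psdm : psd m.
  have := psdD (psd_rank1 (fun i => 1 - K z z / K i z))
    (psd_scale (fun i => (K i z)^-1) (psdZ (ltW (K0 z z)) (psd_base z cK))).
  apply: eq_psd => i j; rewrite /m.
  by field; rewrite !gt_eqF.
have m_lt1 i j : `|m i j| < 1.
  apply: le_lt_trans (psd_norm_le i j psdm) _.
  have mii k : m k k < 1.
    by rewrite /m ltrBlDr ltrDl divr_gt0 ?mulr_gt0.
  by have := mii i; have := mii j => *; lra.
apply: (@eq_psd _
  (fun i j => (K i z)^-1 * (K j z)^-1 * (K z z * (1 / (1 - m i j))))).
  move=> i j; rewrite /m opprB addrCA subrr addr0.
  by field; rewrite !gt_eqF.
apply: psd_scale; apply: psdZ (ltW (K0 z z)) _.
apply: (@psd_lim _ \oo _ (fun n i j => series (geometric 1 (m i j)) n)).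
  by move=> i j; exact: cvg_geometric_series.
apply: nearW; elim=> [|n IH].
  by apply: eq_psd psd0 => i j; rewrite /series /= big_geq.
apply: eq_psd (psdD IH (psdX n psdm)) => i j.
by rewrite /series /= big_nat_recr //= mul1r.
Qed.

End kernels.

(** * Powers as superpositions of resolvents *)
Section resolvent.
Context {R : realType}.
Implicit Types q s v : R.
Local Notation mu := (@lebesgue_measure R).

(** With [t = expR v] and [la = expR s], the Mellin integrand
    [la^q / (la + t)] of [t^(q-1)] is [expR ((q-1) * v) * logistic q (s - v)], so that
    the homogeneity of the integral in [t] becomes translation invariance. *)
Definition logistic q s : R := expR (q * s) / (1 + expR s).

Lemma logistic_gt0 q s : 0 < logistic q s.
Proof. by rewrite divr_gt0 ?addr_gt0 ?expR_gt0. Qed.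

Lemma continuous_logistic q : continuous (logistic q).
Proof.
move=> s; apply: cvgM.
  apply: continuous_comp; last exact: continuous_expR.
  by apply: cvgM; [exact: cvg_cst | exact: cvg_id].
apply: cvgV; first by rewrite gt_eqF ?addr_gt0 ?expR_gt0.
by apply: cvgD; [exact: cvg_cst | exact: continuous_expR].
Qed.

Lemma measurable_logistic q (D : set R) : measurable_fun D (logistic q).
Proof.
apply: measurable_funTS.
exact: continuous_measurable_fun (@continuous_logistic q).
Qed.

(** Domination by an exponential density: [logistic q s <= expR (- (1 - q) * s)]. *)
Lemma logistic_half q : q < 1 ->
  (\int[mu]_(s in `[0%R, +oo[) (logistic q s)%:E < +oo)%E.
Proof.
move=> q1; have q1' : 0 < 1 - q by rewrite subr_gt0.
pose f s := (((1 - q)^-1)%:E * (exponential_pdf (1 - q) s)%:E)%E.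
have mpdf (D : set R) : measurable_fun D (@exponential_pdf R (1 - q)).
  by apply: measurable_funTS; exact: measurable_exponential_pdf.
apply: (@le_lt_trans _ _ (\int[mu]_(s in `[0%R, +oo[) f s)%E).
  apply: ge0_le_integral => //=.
  - by move=> s _; rewrite lee_fin ltW ?logistic_gt0.
  - by apply/measurable_EFinP; exact: measurable_logistic.
  - by apply: measurable_funeM; apply/measurable_EFinP; exact: mpdf.
  move=> s /=; rewrite in_itv /= andbT => s0.
  rewrite /f -EFinM lee_fin exponential_pdfE // mulKf ?gt_eqF //.
  rewrite ler_pdivrMr ?addr_gt0 ?expR_gt0 // mulrDr mulr1 -expRD.
  have -> : - (1 - q) * s + s = q * s by ring.
  by rewrite lerDr expR_ge0.
rewrite ge0_integralZl_EFin ?invr_ge0 ?(ltW q1') //; last 2 first.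
- by move=> s _; rewrite lee_fin exponential_pdf_ge0 // ltW.
- by apply/measurable_EFinP; exact: mpdf.
apply: (@le_lt_trans _ _ (((1 - q)^-1)%:E * 1)%E); last by rewrite mule1 ltry.
apply: lee_wpmul2l; first by rewrite lee_fin invr_ge0 ltW.
rewrite -(integral_exponential_pdf q1'); apply: ge0_subset_integral => //.
  by apply/measurable_EFinP; exact: mpdf.
by move=> s _; rewrite lee_fin exponential_pdf_ge0 // ltW.
Qed.

Lemma logistic_opp q s : logistic q (- s) = logistic (1 - q) s.
Proof.
rewrite /logistic expRN mulrN -mulNr.
have -> : (1 - q) * s = (- q) * s + s by ring.
rewrite expRD; have := expR_gt0 s; set e := expR s => e0.
by field; rewrite !gt_eqF // ?addr_gt0.
Qed.

(** The reflection [s -> - s] exchanges [q] and [1 - q], so that [logistic_half]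
    bounds both half-lines; positivity is read off on [0 <= s <= 1]. *)
Lemma logistic_integral q : 0 < q -> q < 1 ->
  exists2 c : R, 0 < c & (\int[mu]_s (logistic q s)%:E = c%:E)%E.
Proof.
move=> q0 q1.
have g0 (D : set R) : (forall s, D s -> 0 <= (logistic q s)%:E)%E.
  by move=> s _; rewrite lee_fin ltW ?logistic_gt0.
have fin : (\int[mu]_s (logistic q s)%:E < +oo)%E.
  rewrite -setC0 -(set_itvoc0 0%R) setCitv /= ge0_integral_setU //=; first last.
  - rewrite disj_set2E; apply/eqP; rewrite -subset0 => x []/= /[!in_itv]/=.
    by rewrite leNgt andbT => /negP.
  - by move=> s _; rewrite lee_fin ltW ?logistic_gt0.
  - by apply/measurable_EFinP; exact: measurable_logistic.
  rewrite integral_itv_obnd_cbnd; last first.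
    by apply/measurable_EFinP; exact: measurable_logistic.
  rewrite lte_add_pinfty ?logistic_half //.
  rewrite -oppr0 ge0_integration_by_substitutionNy ?oppr0 //; last first.
  - by move=> s _; rewrite ltW ?logistic_gt0.
  - exact/continuous_subspaceT/continuous_logistic.
  under eq_integral do rewrite /= logistic_opp.
  by apply: logistic_half; rewrite ltrBlDr ltrDl.
have pos : ((1 + expR 1)^-1%:E <= \int[mu]_s (logistic q s)%:E)%E.
  apply: (@le_trans _ _ (\int[mu]_(s in `[0%R, 1%R]) (logistic q s)%:E)%E); last first.
    apply: ge0_subset_integral => //.
      by apply/measurable_EFinP; exact: measurable_logistic.
    exact: g0.
  have -> : ((1 + expR 1)^-1%:E =
      \int[mu]_(s in `[0%R, 1%R]) (cst (1 + expR 1)^-1%:E) s)%E.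
    by rewrite integral_cst //= lebesgue_measure_itv /= lte_fin ltr01 oppr0 adde0 mule1.
  apply: ge0_le_integral => //=.
  - by apply/measurable_EFinP; exact: measurable_logistic.
  move=> s /=; rewrite in_itv /= => /andP[s0 s1].
  rewrite lee_fin /logistic -[leLHS]mul1r ler_pM ?invr_ge0 ?addr_ge0 ?expR_ge0 //.
    by rewrite -expR0 ler_expR mulr_ge0 // ltW.
  by rewrite lef_pV2 ?posrE ?addr_gt0 ?expR_gt0 // lerD2l ler_expR.
have ge0 : (0 <= \int[mu]_s (logistic q s)%:E)%E by apply: integral_ge0 => s; exact: g0.
exists (fine (\int[mu]_s (logistic q s)%:E)).
  rewrite -lte_fin fineK; last by rewrite ge0_fin_numE.
  by apply: lt_le_trans pos; rewrite lte_fin invr_gt0 addr_gt0 ?expR_gt0.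
by rewrite fineK // ge0_fin_numE.
Qed.

Lemma logistic_shift q v :
  (\int[mu]_s (logistic q (s - v))%:E = \int[mu]_s (logistic q s)%:E)%E.
Proof.
have d1 : ((fun s : R => s - v)^`() = cst 1)%classic.
  by apply/funext => s; rewrite derive1E deriveB // derive_id derive_cst subr0.
rewrite [RHS](@increasing_ge0_integration_by_substitutionT _ (fun s => s - v)).
- by apply: eq_integral => s _; rewrite d1 /= mulr1.
- by move=> x y; rewrite ltrD2r.
- by rewrite d1 => ?; exact: cst_continuous.
- by rewrite d1; exact: is_cvg_cst.
- by rewrite d1; exact: is_cvg_cst.
- by move=> x; apply: derivableB.
- exact: cvg_addrr_Ny.
- exact: cvg_addrr.
- exact: continuous_logistic.
- by move=> s; rewrite ltW ?logistic_gt0.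
Qed.

(** The integral of [la^(q-1) / (la + t)] over [la > 0] is [c * t^(q-1)] with a
    finite [c > 0], so [t^(q-1)] lies in the closed convex cone of the functions
    [(la + t)^-1].  This is stated in dual form: a linear functional with
    finite support that is nonnegative on these functions is nonnegative on
    [t^(q-1)]. *)
Lemma powR_resolvent_cone (I : finType) (a t : I -> R) q : 0 < q -> q < 1 ->
  (forall i, 0 < t i) ->
  (forall la, 0 < la -> 0 <= \sum_i a i / (la + t i)) ->
  0 <= \sum_i a i * t i `^ (q - 1).
Proof.
move=> q0 q1 t0 a0; have [c c0 Ec] := logistic_integral q0 q1.
pose g i s := t i `^ (q - 1) * logistic q (s - ln (t i)).
have gE i s : g i s = expR (q * s) / (expR s + t i).
  rewrite /g /logistic /powR gt_eqF // expRB lnK ?posrE //.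
  have -> : q * (s - ln (t i)) = q * s - (q - 1) * ln (t i) - ln (t i) by ring.
  rewrite !expRB lnK ?posrE //; have := t0 i; have := expR_gt0 s.
  have := expR_gt0 ((q - 1) * ln (t i)).
  set E := expR ((q - 1) * _); set S := expR s; move=> E0 S0 ti0.
  by field; rewrite !gt_eqF ?addr_gt0.
have mshift i : measurable_fun setT (fun s => logistic q (s - ln (t i))).
  apply: continuous_measurable_fun => s.
  apply: (@continuous_comp _ _ _ (fun s => s - ln (t i)) (logistic q));
    last exact: continuous_logistic.
  by apply: cvgB; [exact: cvg_id | exact: cvg_cst].
have ishift i : mu.-integrable setT (fun s => (logistic q (s - ln (t i)))%:E).
  apply/integrableP; split; first by apply/measurable_EFinP; exact: mshift.
  under eq_integral => s _ do rewrite /= (gtr0_norm (logistic_gt0 _ _)).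
  by rewrite logistic_shift Ec ltry.
pose f i s := ((a i * t i `^ (q - 1))%:E * (logistic q (s - ln (t i)))%:E)%E.
have If i : (\int[mu]_s f i s = (a i * t i `^ (q - 1) * c)%:E)%E.
  by rewrite integralZl // logistic_shift Ec.
rewrite -(pmulr_lge0 _ c0) -lee_fin mulr_suml -sumEFin.
under eq_bigr do rewrite -If.
rewrite -integral_sum //; last by move=> i; exact: integrableZl.
apply: integral_ge0 => s _.
rewrite (_ : (\sum_i f i s)%E = (expR (q * s) * \sum_i a i / (expR s + t i))%:E).
  by rewrite lee_fin mulr_ge0 ?expR_ge0 // a0 ?expR_gt0.
rewrite mulr_sumr -sumEFin; apply: eq_bigr => i _.
by rewrite /f -EFinM -mulrA -/(g i s) gE mulrCA.
Qed.

End resolvent.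

(** * Powers of conditionally negative definite kernels *)
Section kernel_functions.
Context {R : realType} {I : finType}.
Implicit Types (K t y : I -> I -> R) (v : I -> R).

Lemma psd_resolvent K la : 0 < la -> (forall i j, 0 < K i j) -> cnd K ->
  psd (fun i j => (la + K i j)^-1).
Proof.
move=> la0 K0 cK; apply: psd_inv_cnd => [i j|]; first by rewrite addr_gt0.
exact: cndD (cnd_cst la) cK.
Qed.

Lemma psd_powRN_small K al : 0 < al -> al < 1 -> (forall i j, 0 < K i j) ->
  cnd K -> psd (fun i j => K i j `^ (- al)).
Proof.
move=> al0 al1 K0 cK; split=> [i j|v]; first by rewrite cK.1.
have -> : - al = (1 - al) - 1 by ring.
apply: (@powR_resolvent_cone _ _ (fun p : I * I => v p.1 * v p.2)
  (fun p => K p.1 p.2)) => // [||la la0]; [lra|lra|].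
by have [_] := psd_resolvent la0 K0 cK; apply.
Qed.

(** [K^-al] is the [n]-th Hadamard power of [K^-(al/n)], and [al / n < 1] for
    large [n]. *)
Lemma psd_powRN K al : 0 < al -> (forall i j, 0 < K i j) -> cnd K ->
  psd (fun i j => K i j `^ (- al)).
Proof.
move=> al0 K0 cK; set n := (Num.truncn al).+1.
have n0 : 0 < n%:R :> R by rewrite ltr0n.
have psd_root : psd (fun i j => K i j `^ (- (al / n%:R))).
  apply: psd_powRN_small => //; first by rewrite divr_gt0.
  by rewrite ltr_pdivrMr // mul1r truncnS_gt.
apply: eq_psd (psdX n psd_root) => i j.
rewrite -powR_mulrn ?powR_ge0 // -powRrM; congr (_ `^ _).
by field; rewrite gt_eqF.
Qed.

Lemma cnd_moebius K la : 0 < la -> (forall i j, 0 < K i j) -> cnd K ->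
  cnd (fun i j => K i j / (la + K i j)).
Proof.
move=> la0 K0 cK.
apply: eq_cnd (cnd_cstB_psd 1 (psdZ (ltW la0) (psd_resolvent la0 K0 cK))).
by move=> i j; field; rewrite gt_eqF // addr_gt0.
Qed.

(** [t^q = t * t^(q-1)] is a superposition of the functions [t / (la + t)]. *)
Lemma cnd_powR K q : 0 < q -> q < 1 -> (forall i j, 0 < K i j) -> cnd K ->
  cnd (fun i j => K i j `^ q).
Proof.
move=> q0 q1 K0 cK; split=> [i j|v v0]; first by rewrite cK.1.
have := @powR_resolvent_cone R (I * I)%type
  (fun p => - (v p.1 * v p.2 * K p.1 p.2)) (fun p => K p.1 p.2) q q0 q1.
rewrite -oppr_ge0 -sumrN => cone.
rewrite (eq_bigr (fun p => - (v p.1 * v p.2 * K p.1 p.2) * K p.1 p.2 `^ (q - 1))).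
  apply: cone => // la la0.
  have [_ /(_ v v0)] := cnd_moebius la0 K0 cK.
  rewrite -oppr_ge0 -sumrN; congr (is_true (0 <= _)).
  by apply: eq_bigr => p _; ring.
by move=> p _; rewrite -(mulr_powRB1 (ltW (K0 _ _)) q0); ring.
Qed.

(** [t (1 - t^q) / (1 - t)] is [t / (1 - t)] times the difference between the values
    at 1 and at [t] of [x * x^(q-1)], whence the doubling of the index set: the copies
    labelled [true] carry the values at 1.  With the resolvents in place of
    [x^(q-1)], the same combination is
    [t / (1 - t) * (1 / (la + 1) - t / (la + t)) = la / (la + 1) * (t / (la + t))]. *)
Lemma cnd_powR_slope K q : 0 < q -> q < 1 -> (forall i j, 0 < K i j) ->
  (forall i j, K i j != 1) -> cnd K ->
  cnd (fun i j => K i j * (1 - K i j `^ q) / (1 - K i j)).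
Proof.
move=> q0 q1 K0 K1 cK; split=> [i j|v v0]; first by rewrite cK.1.
pose w (p : I * I) := v p.1 * v p.2 * K p.1 p.2 / (1 - K p.1 p.2).
have := @powR_resolvent_cone R ((I * I) * bool)%type
  (fun pb => if pb.2 then - w pb.1 else w pb.1 * K pb.1.1 pb.1.2)
  (fun pb => if pb.2 then 1 else K pb.1.1 pb.1.2) q q0 q1.
have K1' p : 1 - K p.1 p.2 != 0 by rewrite subr_eq0 eq_sym.
have sum2 (F : (I * I) * bool -> R) :
    \sum_pb F pb = \sum_p (F (p, true) + F (p, false)).
  rewrite (eq_bigr (fun pb => F (pb.1, pb.2))) => [|[] //].
  rewrite -(pair_bigA _ (fun p b => F (p, b))) /=.
  by apply: eq_bigr => p _; rewrite big_bool.
rewrite sum2 -oppr_ge0 -sumrN => cone.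
rewrite (eq_bigr (fun p => - w p * 1 `^ (q - 1)
    + w p * K p.1 p.2 * K p.1 p.2 `^ (q - 1))).
  apply: cone => [[p b]|la la0]; first by case: b => /=.
  rewrite sum2 /=.
  have [_ /(_ v v0)] := cnd_moebius la0 K0 cK.
  rewrite -oppr_ge0 => /(mulr_ge0 (ltW (divr_gt0 la0 (addr_gt0 la0 ltr01)))).
  rewrite -sumrN mulr_sumr; congr (is_true (0 <= _)).
  apply: eq_bigr => p _; rewrite /w; field.
  by rewrite K1' !gt_eqF ?addr_gt0.
move=> p _; rewrite powR1 -[w p * _ * _]mulrA mulr_powRB1 ?(ltW (K0 _ _)) //.
by rewrite /w; field; rewrite K1'.
Qed.

End kernel_functions.

(** * The radial profile *)
Section profile.
Context {R : realType}.
Implicit Types r t p : R.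

Definition profile r t : R :=
  if t == 1 then 1 / r else (1 - t) / (1 - t `^ r).

Lemma powR_eq1 t p : 0 < p -> 0 <= t -> (t `^ p == 1) = (t == 1).
Proof.
move=> p0 t0; apply/eqP/eqP => [|->]; last by rewrite powR1.
move=> /(congr1 (fun x => x `^ p^-1)).
by rewrite -powRrM divff ?gt_eqF // powRr1 // powR1.
Qed.

Lemma powR_slope_gt0 t p : 0 < p -> 0 <= t -> t != 1 ->
  0 < (1 - t `^ p) / (1 - t).
Proof.
move=> p0 t0; have one : 1 `^ p = 1 :> R by rewrite powR1.
rewrite neq_lt => /orP[t1|t1].
  apply: divr_gt0; rewrite subr_gt0 //.
  by rewrite -one gt0_ltr_powR // nnegrE.
rewrite -mulrNN -invrN !opprB; apply: divr_gt0; rewrite subr_gt0 //.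
by rewrite -[X in X < _]one gt0_ltr_powR // nnegrE // ltW.
Qed.

Lemma profile_gt0 r t : 1 <= r -> 0 <= t -> 0 < profile r t.
Proof.
move=> r1 t0; rewrite /profile; case: eqVneq => [_|t1].
  by rewrite divr_gt0 //; lra.
by rewrite -invf_div invr_gt0 powR_slope_gt0 //; lra.
Qed.

(** For [p = 1] and [p = 2] the quotient is [1] and [1 + t]; in between it is
    [1 + t (1 - t^(p-1)) / (1 - t)]. *)
Lemma cnd_powR_quotient (I : finType) (K : I -> I -> R) p : 1 <= p -> p <= 2 ->
  (forall i j, 0 < K i j) -> (forall i j, K i j != 1) -> cnd K ->
  cnd (fun i j => (1 - K i j `^ p) / (1 - K i j)).
Proof.
move=> p1 p2 K0 K1 cK.
have K1' i j : 1 - K i j != 0 by rewrite subr_eq0 eq_sym.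
move: p1; rewrite le_eqVlt => /orP[/eqP <-|p1].
  apply: eq_cnd (cnd_cst 1) => i j.
  by rewrite powRr1 ?ltW // divff.
move: p2; rewrite le_eqVlt => /orP[/eqP ->|p2].
  apply: eq_cnd (cndD (cnd_cst 1) cK) => i j.
  by rewrite powR_mulrn ?(ltW (K0 _ _)) //; field.
have [q0 q1] : 0 < p - 1 /\ p - 1 < 1 by split; lra.
apply: eq_cnd (cndD (cnd_cst 1) (cnd_powR_slope q0 q1 K0 K1 cK)) => i j.
rewrite -(@mulr_powRB1 _ _ p) ?(ltW (K0 _ _)) //; last lra.
by field.
Qed.

Lemma powRV t p : 0 <= t -> t^-1 `^ p = t `^ (- p).
Proof. by move=> t0; rewrite -powR_inv1 // -powRrM mulN1r. Qed.

(** For [r <= 2] the profile is the reciprocal of a cnd kernel in [s].  For [r > 2],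
    [(1 - s) / (1 - s^r) = (1 - s^2) / (1 - (s^2)^(r/2)) * (1 + s)^-1]. *)
Lemma psd_profile (I : finType) (s : I -> I -> R) r al :
  1 <= r -> r <= 4 -> 0 < al -> (forall i j, 0 < s i j) ->
  (forall i j, s i j != 1) -> cnd (fun i j => s i j ^+ 2) ->
  psd (fun i j => profile r (s i j) `^ al).
Proof.
move=> r1 r4 al0 s0 s1 cs2.
have s20 i j : 0 < s i j ^+ 2 by rewrite exprn_gt0.
have cs : cnd s.
  have h0 : 0 < 2^-1 :> R by lra.
  have h1 : 2^-1 < 1 :> R by lra.
  apply: eq_cnd (cnd_powR h0 h1 s20 cs2) => i j.
  by rewrite powR12_sqrt ?ltW // sqrtr_sqr gtr0_norm.
have main p (K : I -> I -> R) : 1 <= p -> p <= 2 -> (forall i j, 0 < K i j) ->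
    (forall i j, K i j != 1) -> cnd K ->
    psd (fun i j => profile p (K i j) `^ al).
  move=> p1 p2 K0 K1 cK.
  have sl0 i j : 0 < (1 - K i j `^ p) / (1 - K i j).
    by rewrite powR_slope_gt0 ?(ltW (K0 _ _)) //; lra.
  apply: eq_psd (psd_powRN al0 sl0 (cnd_powR_quotient p1 p2 K0 K1 cK)) => i j.
  by rewrite /profile (negPf (K1 i j)) -invf_div powRV // ltW.
have [r2|r2] := leP r 2; first exact: main.
have s21 i j : s i j ^+ 2 != 1.
  by rewrite sqrf_eq1 negb_or s1 /= gt_eqF // (lt_trans _ (s0 i j)) // oppr_lt0.
have cs1 := cndD (cnd_cst 1) cs.
have s10 i j : 0 < 1 + s i j by rewrite addr_gt0.
have [p1 p2] : 1 <= r / 2 /\ r / 2 <= 2 by split; lra.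
apply: eq_psd (psdM (main _ _ p1 p2 s20 s21 cs2) (psd_powRN al0 s10 cs1)) => i j.
rewrite -powRV ?(ltW (s10 _ _)) // -powRM ?invr_ge0 ?(ltW (s10 _ _)) //; last first.
  by rewrite ltW // profile_gt0 // ltW.
congr (_ `^ _); rewrite /profile (negPf (s1 i j)) (negPf (s21 i j)).
rewrite -powR_mulrn ?(ltW (s0 _ _)) // -powRrM.
have -> : 2 * (r / 2) = r by field.
have sr1 : 1 - s i j `^ r != 0.
  by rewrite subr_eq0 eq_sym powR_eq1 ?(ltW (s0 _ _)) //; lra.
rewrite powR_mulrn ?(ltW (s0 _ _)) //; field.
by rewrite sr1 gt_eqF.
Qed.

Lemma continuous_powR_gt0 p t : 0 < t -> {for t, continuous (@powR R ^~ p)}.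
Proof.
move=> t0; apply/differentiable_continuous/derivable1_diffP.
by apply: derivable_powR; rewrite in_itv /= andbT.
Qed.

(** By L'Hopital's rule. *)
Lemma profile_cvg1 r : 1 <= r -> profile r t @[t --> (1 : R)] --> profile r 1.
Proof.
move=> r1; apply/continuous_withinNx; rewrite {2}/profile eqxx.
have pos (x : R) : x \in `]0, 2[ `\ 1 -> 0 < x.
  by rewrite inE => -[/=]; rewrite in_itv /= => /andP[].
apply: cvg_trans (@lhopital R (fun t => 1 - t) (fun=> - 1) (fun t => 1 - t `^ r)
  (fun t => - (r * t `^ (r - 1))) 0 2 1 (1 / r) _ _ _ _ _ _ _).
- apply: near_eq_cvg; near=> t.
  by rewrite /profile ifF //; apply/negbTE; near: t; exact: nbhs_dnbhs_neq.
- by rewrite in_itv /=; apply/andP; split; lra.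
- move=> x /pos x0; rewrite -[- 1]add0r; exact: is_deriveB.
- move=> x /pos x0; rewrite -[X in is_derive _ _ _ X]add0r.
  exact: is_deriveB (is_derive1_powR r x0).
- rewrite -[X in _ --> X](subrr 1); apply: cvgB; [exact: cvg_cst|exact: cvg_id].
- have one : 1 `^ r = 1 :> R by rewrite powR1.
  rewrite -[X in _ --> X](subrr 1) -[X in _ - X]one.
  by apply: cvgB; [exact: cvg_cst|exact: continuous_powR_gt0].
- move=> x /pos x0; rewrite oppr_eq0 mulf_neq0 ?gt_eqF ?powR_gt0 //; lra.
have -> : 1 / r = - 1 / - (r * 1 `^ (r - 1)).
  by rewrite powR1 mulr1 invrN mulrNN.
apply: cvgM; first exact: cvg_cst.
apply: cvgV; first by rewrite powR1 mulr1 oppr_eq0 gt_eqF //; lra.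
by apply: cvgN; apply: cvgM; [exact: cvg_cst|exact: continuous_powR_gt0].
Unshelve. all: by end_near. Qed.

Lemma cvg_powR_ge0 {T : Type} {F : set_system T} {FF : Filter F} (u : T -> R)
    (l p : R) : 1 <= p -> (forall x, 0 <= u x) -> 0 <= l -> u @ F --> l ->
  u x `^ p @[x --> F] --> l `^ p.
Proof.
move=> p1 u0; rewrite le_eqVlt => /orP[/eqP <- ul|l0 ul]; last first.
  exact: (cvg_comp _ _ ul (continuous_powR_gt0 l0)).
rewrite powR0; last by rewrite gt_eqF //; lra.
apply: (squeeze_cvgr _ (cvg_cst 0) ul); near=> x.
rewrite powR_ge0 /=; have [->|ux0] := eqVneq (u x) 0.
  by rewrite powR0 // gt_eqF //; lra.
rewrite ge1r_powR // lt_neqAle eq_sym ux0 u0 /=.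
by near: x; apply: (cvgr_le 0 ul).
Unshelve. all: by end_near. Qed.

Lemma cvg_profile {T : Type} {F : set_system T} {FF : Filter F} (u : T -> R)
    (l r : R) : 1 <= r -> (forall x, 0 <= u x) -> 0 <= l -> u @ F --> l ->
  profile r (u x) @[x --> F] --> profile r l.
Proof.
move=> r1 u0 l0 ul; have [l1|l1] := eqVneq l 1.
  by rewrite l1 in ul *; exact: (cvg_comp _ _ ul (profile_cvg1 r1)).
rewrite {2}/profile (negPf l1).
have cnum : 1 - u x @[x --> F] --> 1 - l by apply: cvgB => //; exact: cvg_cst.
have l1' : 1 - l != 0 by rewrite subr_eq0 eq_sym.
have u1 : \forall x \near F, 1 - u x != 0 by exact: cvgr_neq0 cnum l1'.
apply: (@cvg_trans _ ((1 - u x) / (1 - u x `^ r) @[x --> F])).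
  apply: near_eq_cvg; apply: filterS u1 => x.
  by rewrite /profile subr_eq0 eq_sym => /negPf ->.
apply: cvgM => //.
apply: cvgV; first by rewrite subr_eq0 eq_sym powR_eq1 //; lra.
by apply: cvgB; [exact: cvg_cst|exact: cvg_powR_ge0].
Unshelve. all: by end_near. Qed.

Lemma cvg_profile_powR {T : Type} {F : set_system T} {FF : Filter F}
    (u : T -> R) (l r al : R) : 1 <= r ->
  (forall x, 0 <= u x) -> 0 <= l -> u @ F --> l ->
  profile r (u x) `^ al @[x --> F] --> profile r l `^ al.
Proof.
move=> r1 u0 l0 ul.
exact: (cvg_comp _ _ (cvg_profile r1 u0 l0 ul)
  (continuous_powR_gt0 (profile_gt0 r1 l0))).
Qed.

End profile.

(** * Kernels of Euclidean distances *)
Section euclidean.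
Context {R : realType}.

Lemma cnd_sqr_dist (I : finType) (a : I -> R) :
  cnd (fun i j => (a i - a j) ^+ 2).
Proof.
split=> [i j|v v0]; first by rewrite -sqrrN opprB.
have sv1 : \sum_i v i * 1 = 0 by rewrite -[RHS]v0; apply: eq_bigr => i _; rewrite mulr1.
have := qform_prod (fun i => a i ^+ 2) (fun=> 1) v.
have := qform_prod (fun=> 1) (fun i => a i ^+ 2) v.
have := qform_prod a a v; rewrite sv1 mulr0 mul0r => eaa e1 e2.
have -> : qform (fun i j => (a i - a j) ^+ 2) v =
    qform (fun i j => a i ^+ 2 * 1) v + qform (fun i j => 1 * a j ^+ 2) v
    + -2 * qform (fun i j => a i * a j) v.
  by rewrite -qformZ -!qformD; apply: eq_qform => i j; ring.
rewrite eaa e1 e2 addr0 add0r mulNr oppr_le0 mulr_ge0 //.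
by rewrite -expr2 sqr_ge0.
Qed.

Lemma cnd_sum (I J : finType) (K : J -> I -> I -> R) :
  (forall k, cnd (K k)) -> cnd (fun i j => \sum_k K k i j).
Proof.
move=> cK; elim: (index_enum J) => [|k l IH].
  by apply: eq_cnd (cnd_cst 0) => i j; rewrite big_nil.
by apply: eq_cnd (cndD (cK k) IH) => i j; rewrite big_cons.
Qed.

Lemma enorm_ge0 n (x : 'rV[R]_n) : 0 <= enorm x.
Proof. exact: sqrtr_ge0. Qed.

Lemma continuous_enorm n : continuous (@enorm R n).
Proof.
move=> x; apply: (@continuous_comp _ _ _
  (fun x : 'rV[R]_n => \sum_i x 0 i ^+ 2) Num.sqrt); last exact: sqrt_continuous.
move: x; apply: (@continuous_big _ _ _ _ _ add_continuous) => i _ x.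
have c : {for x, continuous (fun y : 'rV[R]_n => y 0 i)}.
  exact: coord_continuous.
exact: (cvgM c c).
Qed.

Lemma psd_psdmx m (K : 'I_m -> 'I_m -> R) :
  psd K -> psdmx (\matrix_(i < m, j < m) K i j).
Proof.
move=> [sK pK]; split; first by apply/matrixP => i j; rewrite !mxE.
move=> v; have := pK (v 0); congr (is_true (0 <= _)).
rewrite /qform -(pair_bigA _ (fun i j => v 0 i * v 0 j * K i j)) /=.
rewrite mxE exchange_big; apply: eq_bigr => j _ /=.
rewrite !mxE mulr_suml; apply: eq_bigr => i _.
by rewrite mxE mulrAC.
Qed.

(** The distances are replaced by [sqrt (|x_i - x_j|^2 + e)], which differ from 0
    and 1 for all small [e > 0]. *)
Lemma psd_norm_quotient n m (x : 'I_m -> 'rV[R]_n) r al :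
  1 <= r -> r <= 4 -> 0 < al ->
  psd (fun i j => norm_quotient r (x i - x j) `^ al).
Proof.
move=> r1 r4 al0.
pose N i j : R := \sum_k (x i - x j) 0 k ^+ 2.
have N0 i j : 0 <= N i j by apply: sumr_ge0 => k _; exact: sqr_ge0.
have cN : cnd N.
  apply: cnd_sum => k.
  by apply: eq_cnd (cnd_sqr_dist (fun i => x i 0 k)) => i j; rewrite !mxE.
pose s e i j := Num.sqrt (N i j + e).
apply: (@psd_lim _ _ _ (0^'+) _ (fun e i j => profile r (s e i j) `^ al)).
  move=> i j; apply: cvg_profile_powR => //; first by move=> e; exact: sqrtr_ge0.
    exact: enorm_ge0.
  have cNe : N i j + e @[e --> (0 : R)^'+] --> N i j.
    rewrite -[X in _ --> X]addr0; apply: cvgD; first exact: cvg_cst.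
    exact/cvg_at_right_filter/cvg_id.
  by apply: (cvg_comp _ _ cNe); exact: sqrt_continuous.
have e0 : \forall e \near (0 : R)^'+, 0 < e by exact: nbhs_right_gt.
have Ne : \forall e \near (0 : R)^'+, forall i j, N i j + e != 1.
  apply: filter_forall => i; apply: filter_forall => j.
  have [Nij|Nij] := ltP (N i j) 1.
    near=> e; rewrite lt_eqF // -ltrBrDl.
    by near: e; apply: nbhs_right_lt; rewrite subr_gt0.
  apply: filterS e0 => e e_gt0.
  by rewrite gt_eqF // -[ltLHS]addr0 ler_ltD.
near=> e.
have e_gt0 : 0 < e by near: e.
have Ne1 i j : N i j + e != 1 by move: i j; near: e.
have Ne0 i j : 0 < N i j + e by rewrite ltr_wpDl.
have s2 i j : s e i j ^+ 2 = N i j + e by rewrite sqr_sqrtr ?ltW.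
apply: psd_profile => // [i j|i j|].
- by rewrite sqrtr_gt0.
- by apply: contra (Ne1 i j) => /eqP se; rewrite -s2 se expr1n.
by apply: eq_cnd (cndD cN (cnd_cst e)) => i j; rewrite s2.
Unshelve. all: by end_near. Qed.

End euclidean.

Theorem mainTheorem4 (R : realType) (r : R) (hr1 : 1 <= r) (hr4 : r <= 4)
    (n : nat) (hn : (0 < n)%N) :
  infinitely_divisible (@norm_quotient R r n).
Proof.
(* By conversion, [norm_quotient r x] is [profile r (enorm x)]. *)
split=> [x|al al0]; first exact: ltW (profile_gt0 hr1 (enorm_ge0 x)).
split=> [x|m x _]; last exact/psd_psdmx/psd_norm_quotient.
exact: (cvg_profile_powR (u := @enorm R n) hr1 (@enorm_ge0 R n) (enorm_ge0 x)
  (@continuous_enorm R n x)).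
Qed.
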